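(* Let $n$ be a positive integer and let $\ell,\mathrm{maj}:S_{n+1}\to\mathbb{Z}$ be the length and the major index. Then $$|\mathrm{Im}(\ell+\mathrm{maj})|=\begin{cases}2, & \text{if } n=1;\\ n(n+1)-1, & \text{otherwise.}\end{cases}$$
   Context: $S_{n+1}$ is the group of permutations of $[n+1]=\{1,\dots,n+1\}$, whose elements are written as sequences $(\sigma(1),\dots,\sigma(n+1))$. $\ell$ is the Coxeter length with respect to the adjacent transpositions, equivalently $\ell(\sigma)$ is the number of inversions of $\sigma$, i.e. of pairs $i<j$ with $\sigma(i)>\sigma(j)$. The major index is $\mathrm{maj}(\sigma)=\sum_{i\in D(\sigma)}i$, where $D(\sigma)=\{i\in[n]:\sigma(i)>\sigma(i+1)\}$. $\mathrm{Im}(h)$ denotes the set of values of a function $h$. *)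

(* Defs.v *)
From HB Require Import structures.
From mathcomp Require Import all_boot all_order all_algebra all_fingroup.
From mathcomp Require Import finmap.

Set Implicit Arguments.
Unset Strict Implicit.
Unset Printing Implicit Defensive.

Import GroupScope.

(* ['S_n.+1] acts on [{0, ..., n}]; the point [k] of [{1, ..., n+1}] is encoded
   by the ordinal [k - 1], and an index of [{1, ..., n}] by an ordinal of
   ['I_n]. The two maps below send [i : 'I_n] to [i] and [i + 1] in ['I_n.+1]. *)
Definition lo (n : nat) (i : 'I_n) : 'I_n.+1 := widen_ord (leqnSn n) i.
Definition hi (n : nat) (i : 'I_n) : 'I_n.+1 := lift ord0 i.

Definition adj_tperm (n : nat) (i : 'I_n) : 'S_n.+1 := tperm (lo i) (hi i).

Definition has_word (n : nat) (s : 'S_n.+1) (k : nat) : bool :=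
  [exists w : k.-tuple 'I_n, s == \prod_(i <- w) adj_tperm i].

Lemma has_word_seq (n : nat) (s : 'S_n.+1) (w : seq 'I_n) :
  s = \prod_(i <- w) adj_tperm i -> has_word s (size w).
Proof. by move=> e; apply/existsP; exists (in_tuple w); apply/eqP. Qed.

Lemma tperm_word (n : nat) (x y : 'I_n.+1) :
  exists w : seq 'I_n, tperm x y = \prod_(i <- w) adj_tperm i.
Proof.
wlog le_xy: x y / x <= y.
  by move=> W; case/orP: (leq_total x y) => /W //; rewrite tpermC.
have [d] := ubnP (y - x); elim: d x y le_xy => // d IHd x y le_xy led.
have [-> | neq_xy] := eqVneq x y; first by exists [::]; rewrite big_nil tperm1.
have lt_xy : x < y by rewrite ltn_neqAle le_xy andbT.
have lt_xn : x < n by rewrite (leq_trans lt_xy) // -ltnS.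
pose i := Ordinal lt_xn.
have lo_i : lo i = x by apply: val_inj.
have hi_val : hi i = x.+1 :> nat by [].
have [||w Ew] := IHd (hi i) y; first by rewrite hi_val.
  by rewrite hi_val subnS prednK ?subn_gt0.
have [-> | neq_hy] := eqVneq y (hi i).
  by exists [:: i]; rewrite big_seq1 /adj_tperm lo_i.
exists (i :: rcons w i).
have hx : hi i != x by rewrite -val_eqE /= neq_ltn ltnSn orbT.
rewrite big_cons -cats1 big_cat big_seq1 -Ew /= /adj_tperm lo_i.
set t := tperm x (hi i); have tV : t^-1 = t by apply: tpermV.
have -> : t * (tperm (hi i) y * t) = tperm (hi i) y ^ t by rewrite conjgE tV.
by rewrite tpermJ tpermR tpermD // eq_sym.
Qed.

Lemma has_word_ex (n : nat) (s : 'S_n.+1) : exists k, has_word s k.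
Proof.
suff [w Ew] : exists w : seq 'I_n, s = \prod_(i <- w) adj_tperm i.
  by exists (size w); apply: has_word_seq.
have [ts -> _] := prod_tpermP s.
elim: ts => [|t ts [w Ew]]; first by exists [::]; rewrite !big_nil.
have [v Ev] := tperm_word t.1 t.2.
by exists (v ++ w); rewrite big_cons big_cat Ev Ew.
Qed.

Definition ell (n : nat) (s : 'S_n.+1) : nat := ex_minn (has_word_ex s).

Definition maj (n : nat) (s : 'S_n.+1) : nat :=
  \sum_(i < n | s (hi i) < s (lo i)) i.+1.

Definition Im (T : finType) (K : choiceType) (h : T -> K) : {fset K} :=
  [fset h x | x in T]%fset.

(* Main.v *)
Require Import Defs.
From mathcomp Require Import all_boot all_order all_algebra all_fingroup.
From mathcomp Require Import finmap.
From mathcomp Require Import zify.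

Set Implicit Arguments.
Unset Strict Implicit.
Unset Printing Implicit Defensive.

(** Write M = n(n+1), twice the number of pairs of positions i < j. The length is the
    number of inversions, because left multiplication by an adjacent
    transposition changes that number by exactly one, and every permutation
    other than 1 has a descent at which it can be lowered. Hence the statistic
    [stat = inv + maj] takes its values in [0, M], and two symmetric facts
    govern which of them occur.

    - Replacing s by its complement (every value k in {0, ..., n} becomes n - k) exchanges
      inversions with non-inversions and descents with ascents, so [stat]
      becomes M - [stat] ([stat_compl]).
    - If s is not 1, it has a descent, which gives at least one inversion and
      contributes at least 1 to [maj]; so the value 1 is never taken
      ([stat_neq1]), and by complementation neither is M - 1.

    All other values of [0, M] occur ([stat_surj]), by induction on n. Appending
    a new largest value at the end changes neither statistic ([stat_ext]), so
    the values for n persist for n + 1. By complementation only the lower half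
    of the interval has to be covered for n + 1, and the persisting values do so
    as soon as n > 2: besides 1, they leave out M - 1 and everything above M, all of which
    is then above the middle (n+1)(n+2)/2. For n <= 2 this leaves only the
    value 3 in S_3 and the value 5 in S_4, which have explicit witnesses.

    So the image is [0, M] without 1 and M - 1. It has M - 1 elements, except
    that for n = 1 the two excluded values coincide. *)

(** * Inversions and the length *)

Definition inv (n : nat) (s : 'S_n.+1) : nat :=
  \sum_(i < n.+1) \sum_(j < n.+1) ((i < j) && (s j < s i)).

(** Left multiplication by [adj_tperm i] exchanges the entries at the positions
    [lo i] and [hi i]. The transposition preserves the order of every pair of
    positions except this one, so relabelling positions by it matches the
    inversions of both sides, up to the single new inversion created here. *)
Lemma inv_adj_ascent (n : nat) (i : 'I_n) (s : 'S_n.+1) :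
  s (lo i) < s (hi i) -> inv (adj_tperm i * s)%g = (inv s).+1.
Proof.
move=> asc; rewrite /inv /adj_tperm.
set t := tperm _ _; have tK : involutive t by apply: tpermK.
have hiE : hi i = i.+1 :> nat by [].
have loE : lo i = i :> nat by [].
have one : \sum_(a < n.+1) \sum_(b < n.+1) ((a == hi i) && (b == lo i)) = 1.
  rewrite (bigD1 (hi i)) //= (bigD1 (lo i)) //= !eqxx.
  rewrite big1 => [|b /negbTE->]; last by rewrite andbF.
  by rewrite big1 // => a /negbTE->; rewrite big1.
(* After reindexing, the identity holds term by term, the extra inversion being
   the indicator of the pair (hi i, lo i). *)
rewrite -[RHS]add1n -[X in _ = X + _]one -big_split /=.
rewrite (reindex_inj (@perm_inj _ t)) /=; apply: eq_bigr => a _.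
rewrite -big_split (reindex_inj (@perm_inj _ t)) /=; apply: eq_bigr => b _.
rewrite !permM !tK.
have neq c : c <> lo i -> c <> hi i -> (c != i :> nat) && (c != i.+1 :> nat).
  move=> clo chi; apply/andP; split; apply/eqP => E;
    by [apply: clo; apply: val_inj | apply: chi; apply: val_inj].
rewrite -!(inj_eq val_inj) /= -/(lo i).
rewrite /t; case: tpermP => [->|->|/neq na /na {na}];
  case: tpermP => [->|->|/neq nb /nb {nb}];
  rewrite ?hiE ?loE /bump leq0n; lia.
Qed.

Lemma inv_adj_descent (n : nat) (i : 'I_n) (s : 'S_n.+1) :
  s (hi i) < s (lo i) -> inv s = (inv (adj_tperm i * s)%g).+1.
Proof.
move=> desc; rewrite -(@inv_adj_ascent _ i); last by rewrite !permM tpermL tpermR.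
by rewrite mulgA tperm2 mul1g.
Qed.

(** A permutation without descents satisfies i <= s i for all i, by induction
    along the positions; as the values and the positions have the same sum,
    equality holds everywhere. *)
Lemma descent_ex (n : nat) (s : 'S_n.+1) :
  s != 1%g -> exists i : 'I_n, s (hi i) < s (lo i).
Proof.
move=> s_neq1; apply/existsP; apply: contraR s_neq1 => /existsPn noD.
have le_s (k : nat) (i : 'I_n.+1) : i = k :> nat -> k <= s i.
  elim: k i => // k IHk i ik.
  have lt_kn : k < n by rewrite -ltnS -ik.
  have Ei : i = hi (Ordinal lt_kn) by apply: val_inj.
  have /IHk leks : lo (Ordinal lt_kn) = k :> nat by [].
  have := noD (Ordinal lt_kn); rewrite -leqNgt leq_eqVlt -Ei.
  case/orP=> [/eqP/val_inj/perm_inj E|]; last exact: leq_ltn_trans.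
  by have := congr1 val E; rewrite /= ik; lia.
have : \sum_(i < n.+1) (s i - i) = 0.
  rewrite sumnB => [|i _]; last exact: le_s.
  by rewrite [X in _ - X](reindex_inj (@perm_inj _ s)) /= subnn.
move/eqP; rewrite sum_nat_eq0 => /forallP le_i.
apply/eqP/permP=> i; rewrite perm1; apply/val_inj/eqP => /=.
by rewrite eqn_leq (le_s i) // andbT -subn_eq0; apply: le_i.
Qed.

Lemma inv1 (n : nat) : inv (1%g : 'S_n.+1) = 0.
Proof.
by apply: big1 => i _; apply: big1 => j _; rewrite !perm1; case: ltngtP.
Qed.

Lemma maj1 (n : nat) : maj (1%g : 'S_n.+1) = 0.
Proof. by apply: big_pred0 => i; rewrite !perm1 /= /bump; lia. Qed.

(** Sorting a permutation by descents yields a word of length [inv s]; conversely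
    each letter of a word creates at most one inversion. *)
Lemma ellE (n : nat) (s : 'S_n.+1) : ell s = inv s.
Proof.
rewrite /ell; case: ex_minnP => k /existsP[w /eqP Ew] k_min.
apply/eqP; rewrite eqn_leq; apply/andP; split.
  suff [v Ev <-] : exists2 v : seq 'I_n,
      s = (\prod_(i <- v) adj_tperm i)%g & size v = inv s.
    exact/k_min/has_word_seq.
  elim: {k w Ew k_min}(inv s) {-2}s (erefl (inv s)) => [|m IHm] u Eu.
    exists [::] => //; rewrite big_nil; apply/eqP; apply: contraTT isT => u1.
    by have [i /inv_adj_descent] := descent_ex u1; rewrite Eu.
  have [i desc] : exists i : 'I_n, u (hi i) < u (lo i).
    by apply/descent_ex/eqP => u1; rewrite u1 inv1 in Eu.
  have [|v Ev size_v] := IHm (adj_tperm i * u)%g.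
    by have := inv_adj_descent desc; rewrite Eu => -[].
  exists (i :: v); first by rewrite big_cons -Ev mulgA tperm2 mul1g.
  by rewrite /= size_v -(inv_adj_descent desc).
rewrite Ew -[X in _ <= X](size_tuple w).
elim: (tval w) => [|i v IHv]; first by rewrite big_nil inv1.
rewrite big_cons /=; set u := (\prod_(j <- v) _)%g in IHv *.
have [asc|desc|/val_inj/perm_inj/(congr1 val) /=] := ltngtP (u (lo i)) (u (hi i)).
- by rewrite inv_adj_ascent.
- by move: IHv; rewrite (inv_adj_descent desc) => /ltnW/leqW.
- by rewrite /bump leq0n; lia.
Qed.

(** * The sum of both statistics and its symmetry *)

Definition stat (n : nat) (s : 'S_n.+1) : nat := inv s + maj s.

(** A descent forces both [inv] and [maj] to be positive, so [stat] jumps from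
    0, at the identity, to at least 2. *)
Lemma stat_neq1 (n : nat) (s : 'S_n.+1) : stat s <> 1.
Proof.
rewrite /stat; have [->|/descent_ex[i desc]] := eqVneq s 1%g.
  by rewrite inv1 maj1.
by rewrite (inv_adj_descent desc) /maj (bigD1 i) //= addSn addnS.
Qed.

Definition compl (n : nat) (s : 'S_n.+1) : 'S_n.+1 := (s * perm (@rev_ord_inj n.+1))%g.

Lemma complE (n : nat) (s : 'S_n.+1) i : compl s i = n - s i :> nat.
Proof. by rewrite permM permE /= subSS. Qed.

Lemma compl_lt (n : nat) (s : 'S_n.+1) i j :
  (compl s j < compl s i) = (s i < s j).
Proof.
by rewrite !complE; have := ltn_ord (s i); have := ltn_ord (s j); lia.
Qed.

(** Each pair of positions i < j is an inversion of exactly one of [s] and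
    [compl s]. *)
Lemma inv_compl (n : nat) (s : 'S_n.+1) : inv s + inv (compl s) = 'C(n.+1, 2).
Proof.
rewrite -big_split /= -bin2_sum big_mkord.
under eq_bigr do rewrite -big_split.
rewrite exchange_big; apply: eq_bigr => j _ /=.
rewrite -[RHS](card_ord j) -sum1_card.
rewrite (big_ord_widen n.+1 (fun=> 1)) ?(ltnW (ltn_ord j)) // [RHS]big_mkcond /=.
apply: eq_bigr => i _; rewrite compl_lt; case: (ltnP i j) => //= ltij.
case: ltngtP => // /val_inj/perm_inj E; by rewrite E ltnn in ltij.
Qed.

(** Each index is a descent of exactly one of [s] and [compl s]. *)
Lemma maj_compl (n : nat) (s : 'S_n.+1) : maj s + maj (compl s) = 'C(n.+1, 2).
Proof.
rewrite -bin2_sum big_mkord big_ord_recl add0n /maj.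
rewrite [RHS](bigID (fun i : 'I_n => s (hi i) < s (lo i))) /=; congr (_ + _).
apply: eq_bigl => i; rewrite compl_lt.
case: ltngtP => // /val_inj/perm_inj/(congr1 val) /=.
by rewrite /bump leq0n; lia.
Qed.

Lemma stat_compl (n : nat) (s : 'S_n.+1) : stat s + stat (compl s) = n * n.+1.
Proof.
rewrite /stat addnACA inv_compl maj_compl addnn bin2 mulnC.
by rewrite -[RHS]odd_double_half oddM /= andbN add0n.
Qed.

(** * The values that occur *)

(** The sequence (s(0), ..., s(n)) followed by the new largest value n + 1. *)
Definition ext (n : nat) (s : 'S_n.+1) : 'S_n.+2 := lift_perm ord_max ord_max s.

Lemma stat_ext (n : nat) (s : 'S_n.+1) : stat (ext s) = stat s.
Proof.
have wE (i : 'I_n.+1) : widen_ord (leqnSn n.+1) i = lift ord_max i.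
  by apply: val_inj; apply/esym/lift_max.
have extE (i : 'I_n.+1) : ext s (widen_ord (leqnSn n.+1) i) = s i :> nat.
  by rewrite wE lift_perm_lift lift_max.
have extM : ext s ord_max = n.+1 :> nat by rewrite lift_perm_id.
congr (_ + _).
  rewrite /inv big_ord_recr /= [X in _ + X]big1 ?addn0 => [|j _].
    apply: eq_bigr => i _; rewrite big_ord_recr /= extM extE.
    rewrite (ltnNge n.+1) (ltnW (ltn_ord _)) andbF addn0.
    by apply: eq_bigr => j _; rewrite !extE.
  by have := ltn_ord j; rewrite ltnS leqNgt => /negbTE->.
rewrite /maj big_mkcond big_ord_recr /= [RHS]big_mkcond /=.
have -> : hi (ord_max : 'I_n.+1) = ord_max by apply: val_inj.
rewrite extM extE ltnNge (ltnW (ltn_ord _)) addn0.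
apply: eq_bigr => i _; rewrite extE.
have -> : hi (widen_ord (leqnSn n) i) = widen_ord (leqnSn n.+1) (hi i).
  exact: val_inj.
by rewrite extE.
Qed.

(** In values from 1 to 3, the sequence (1, 3, 2): one inversion, one descent, at 2. *)
Lemma stat_3 : exists s : 'S_3, stat s = 3.
Proof.
exists (adj_tperm (@Ordinal 2 1 isT)).
rewrite /stat -[adj_tperm _]mulg1 inv_adj_ascent ?inv1 ?perm1 // mulg1.
by rewrite /maj big_mkcond !big_ord_recl big_ord0 !permE.
Qed.

(** In values from 1 to 4, the sequence (1, 3, 4, 2): two inversions, one
    descent, at 3. *)
Lemma stat_5 : exists s : 'S_4, stat s = 5.
Proof.
pose i1 : 'I_3 := @Ordinal 3 1 isT; pose i2 : 'I_3 := @Ordinal 3 2 isT.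
exists (adj_tperm i2 * adj_tperm i1)%g.
rewrite /stat inv_adj_ascent; last by rewrite !permE.
rewrite -[adj_tperm i1]mulg1 inv_adj_ascent ?inv1 ?perm1 // mulg1.
by rewrite /maj big_mkcond !big_ord_recl big_ord0 !(permM, permE).
Qed.

(** The cases left over by extension and complementation: a value v with
    2v <= (n+1)(n+2) that is not obtained from S_(n+1) has v >= n(n+1) - 1,
    which forces n <= 2. *)
Lemma stat_surj (n v : nat) :
  v <= n * n.+1 -> v <> 1 -> v.+1 <> n * n.+1 -> exists s : 'S_n.+1, stat s = v.
Proof.
elim: n v => [|n IHn] v.
  by rewrite leqn0 => /eqP-> _ _; exists 1%g; rewrite /stat inv1 maj1.
wlog small : v / v.*2 <= n.+1 * n.+2 => [W|] le_v v1 vM.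
  have [|big] := leqP v.*2 (n.+1 * n.+2); first by move/W; apply.
  have [||||s Es] := W (n.+1 * n.+2 - v); try lia.
  by exists (compl s); have := stat_compl s; lia.
have [/andP[le_vn /eqP vn]|] := boolP ((v <= n * n.+1) && (v.+1 != n * n.+1)).
  by have [s <-] := IHn v le_vn v1 vn; exists (ext s); apply: stat_ext.
rewrite negb_and -ltnNge negbK => high.
have : n <= 2 by nia.
case: n {IHn} => [|[|[|//]]] in le_v vM small high * => _; first lia.
  have -> : v = 3 by lia.
  exact: stat_3.
have -> : v = 5 by lia.
exact: stat_5.
Qed.

Lemma stat_image (n v : nat) :
  (exists s : 'S_n.+1, stat s = v) <->
  [/\ v <= n * n.+1, v <> 1 & v.+1 <> n * n.+1].
Proof.
split=> [[s <-]|[]]; last exact: stat_surj.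
have E := stat_compl s; split; first by lia.
  exact: stat_neq1.
by have := @stat_neq1 _ (compl s); lia.
Qed.

(** * The size of the image *)

Theorem theorem4p1 (n : nat) (n_gt0 : (0 < n)%N) :
  #|` Im (fun s : 'S_n.+1 => ((ell s)%:Z + (maj s)%:Z)%R) |%fset
    = (if n == 1 then 2 else n * (n + 1) - 1)%N.
Proof.
set M := n * n.+1.
pose A := [fset (k : nat) | k in iota 0 M.+1]%fset.
have cardA : #|` A|%fset = M.+1.
  by rewrite card_fseq undup_id ?size_iota ?iota_uniq.
have -> : Im (fun s : 'S_n.+1 => ((ell s)%:Z + (maj s)%:Z)%R)
    = [fset (k%:Z)%R | k in (A `\ 1 `\ M.-1)]%fset.
  apply/fsetP => z; apply/imfsetP/imfsetP => /= [[s _ ->]|[k]].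
    exists (stat s); last by rewrite ellE.
    have /stat_image[] : exists u : 'S_n.+1, stat u = stat s by exists s.
    rewrite !inE mem_iota /M; lia.
  rewrite !inE mem_iota /= => k_in ->.
  have [|||s <-] := @stat_surj n k; try (rewrite /M in k_in; lia).
  by exists s; rewrite ?ellE.
rewrite card_imfset /=; last by move=> a b [].
have card1 : M.+1 = (#|` A `\ 1|%fset).+1.
  by rewrite -cardA (cardfsD1 1 A) !inE mem_iota /M; nia.
have cardM := cardfsD1 M.-1 (A `\ 1)%fset.
rewrite addn1 -/M; have [n1|n_neq1] := eqVneq n 1.
  (* Here M = 2, so that 1 and M - 1 are the same value. *)
  have M2 : M = 2 by rewrite /M n1.
  have M_notin : (M.-1 \in (A `\ 1)%fset) = false by rewrite !inE M2.
  by case: card1; rewrite cardM M_notin => E; apply: etrans (esym E) M2.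
have M_in : M.-1 \in (A `\ 1)%fset by rewrite !inE mem_iota /M; nia.
by case: card1; rewrite cardM M_in add1n => E; rewrite [in RHS]E subn1.
Qed.
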